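(* Let $i\ge1$ be a fixed integer and fix $0<c<1$. Let $m=cn$ and let $\pi$ be chosen uniformly at random from $\mathrm{PF}(m,n)$. Then, as $n\to\infty$, $$\operatorname{Cov}(\pi_1,k_i)\sim-\frac{i}{2(1-c)^2},$$ where $k_i=k_i(\pi)$ is the $i$th unattempted spot of $\pi$.
   Context: Write $[n]=\{1,\dots,n\}$. For integers $0\le m\le n$, $\mathrm{PF}(m,n)$ denotes the set of parking functions with $m$ cars and $n$ spots: sequences $(\pi_1,\dots,\pi_m)\in[n]^m$ such that, when cars $1,\dots,m$ enter in order a one-way street with spots $1,\dots,n$ and car $i$ parks in spot $\pi_i$ if it is free and otherwise in the first free spot after $\pi_i$, all cars park. Equivalently, the non-decreasing rearrangement $(\lambda_1,\dots,\lambda_m)$ satisfies $\lambda_i\le n-m+i$ for all $i$. For $\pi\in\mathrm{PF}(m,n)$ exactly $n-m$ spots are never attempted by any car (they are the spots left empty after all cars have parked); they are listed as $k_1(\pi)<k_2(\pi)<\cdots<k_{n-m}(\pi)$. Here $\sim$ means that the ratio of the two sides tends to $1$; the limit $n\to\infty$ is along integers $n$ with $cn$ an integer (and $n$ large enough that $n-m\ge i$). *)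

(* Defs.v *)
From mathcomp Require Import all_boot all_order all_algebra.
From mathcomp Require Import reals.

Set Implicit Arguments.
Unset Strict Implicit.
Unset Printing Implicit Defensive.

Import Order.TTheory GRing.Theory Num.Theory.

(* The n spots of the street are the ordinals of 'I_n; the ordinal of value s
   stands for spot s + 1 of the street. *)
Definition spot_number (n : nat) (s : 'I_n) : nat := s.+1.

Section Parking.

Variable n : nat.

Implicit Types (occ : {set 'I_n}) (p s : 'I_n) (prefs : seq 'I_n).

(* enum 'I_n is increasing, so the head of the filtered list is the first free
   spot at or after p; None means that the car leaves without parking. *)
Definition parking_spot occ p : option 'I_n :=
  ohead [seq s : 'I_n <- enum 'I_n | (p <= s)%N & s \notin occ].

Definition occupy occ (o : option 'I_n) : {set 'I_n} :=
  if o is Some s then s |: occ else occ.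

(* The successive outcomes of the cars with preferences prefs, entering in
   order a street whose spots in occ are already taken. *)
Fixpoint park occ prefs : seq (option 'I_n) :=
  if prefs is p :: prefs' then
    let o := parking_spot occ p in o :: park (occupy occ o) prefs'
  else [::].

Definition is_parking_function prefs : bool := all isSome (park set0 prefs).

(* A car tries all the spots from its preferred one up to the one it parks in,
   or up to the end of the street when it fails to park. *)
Definition attempts p (o : option 'I_n) s : bool :=
  (p <= s)%N && (if o is Some t then (s <= t)%N else true).

Definition attempted prefs s : bool :=
  has (fun po => attempts po.1 po.2 s) (zip prefs (park set0 prefs)).

Definition unattempted prefs : seq 'I_n :=
  [seq s : 'I_n <- enum 'I_n | ~~ attempted prefs s].

(* Spots are numbered from 1, as are the index i of the unattempted spot
   and the index j of the car; the value is 0 when the index is out of range. *)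
Definition unattempted_spot (i : nat) prefs : nat :=
  nth 0%N (map (@spot_number n) (unattempted prefs)) i.-1.

Definition preference (j : nat) prefs : nat :=
  nth 0%N (map (@spot_number n) prefs) j.-1.

End Parking.

Definition PF (m n : nat) : {set m.-tuple 'I_n} :=
  [set pi : m.-tuple 'I_n | is_parking_function pi]%SET.

Local Open Scope ring_scope.

(* Expectation and covariance for a uniformly random element of a finite set. *)
Definition uexpectation (R : realType) (T : finType) (A : {set T})
    (X : T -> R) : R :=
  (\sum_(x in A) X x) / #|A|%:R.

Definition ucovariance (R : realType) (T : finType) (A : {set T})
    (X Y : T -> R) : R :=
  uexpectation A
    (fun x => (X x - uexpectation A X) * (Y x - uexpectation A Y)).

Definition cov_preference_unattempted (R : realType) (i m n : nat) : R :=
  ucovariance (PF m n)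
    (fun pi => (preference 1 pi)%:R) (fun pi => (unattempted_spot i pi)%:R).

(* Main.v *)
Require Import Defs.
From mathcomp Require Import all_boot all_order all_algebra.
From mathcomp Require Import all_classical all_reals all_analysis.
From mathcomp Require Import ring lra zify.
Import Order.TTheory GRing.Theory Num.Theory.
Import numFieldNormedType.Exports.
Local Open Scope classical_set_scope.
Local Open Scope ring_scope.

Set Implicit Arguments.
Unset Strict Implicit.
Unset Printing Implicit Defensive.

(** Let M = n + 1 and N = M - m. Both the first preference and the unattempted
    spots are read off the word w_1 ... w_n counting the cars that prefer each
    spot; a word stands for m! / (w_1! ... w_n!) preference sequences. The walk
    with steps w_x - 1 started at height N reaches 0 for the first time at M
    exactly when the sequence is a parking function, and k_i is then the first
    time it has gone down by i. Removing the first letter gives recursions for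
    the sums over words of 1, of k_i, of the total of all preferences and of
    their product, which have closed forms in p = M^m / m! and
    e = sum_(l <= m) M^l / l!. They yield the exact formula
      Cov(pi_1, k_i) = - i (N - i) M r / (2 N m),   r = M - N e / p.
    With x = m / M, the quantity r satisfies a first order recursion in m whose
    formal limit is r = x / (1 - x) + x r, whence r -> c / (1 - c)^2. *)

(** * Sums over words *)

Section WordSums.
Variable R : numFieldType.

(* The sum of F w / (w_1! ... w_n!) over the words w of length n and total m. *)
Fixpoint wsum (n m : nat) (F : seq nat -> R) : R :=
  if n is n'.+1 then
    \sum_(c < m.+1) (c`!)%:R^-1 * wsum n' (m - c) (fun w => F (val c :: w))
  else if m == 0%N then F [::] else 0.

Lemma eq_wsum n m F G :
  (forall w, size w = n -> sumn w = m -> F w = G w) -> wsum n m F = wsum n m G.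
Proof.
elim: n m F G => [|n IH] m F G FG /=.
  by case: eqP => // m0; apply: FG.
apply: eq_bigr => c _; congr (_ * _); apply: IH => w sw mw.
by apply: FG => /=; rewrite ?sw ?mw // subnKC // -ltnS.
Qed.

Lemma wsumD n m F G :
  wsum n m (fun w => F w + G w) = wsum n m F + wsum n m G.
Proof.
elim: n m F G => [|n IH] m F G /=; first by case: ifP; rewrite ?addr0.
by rewrite -big_split; apply: eq_bigr => c _; rewrite IH mulrDr.
Qed.

Lemma wsumZ n m a F : wsum n m (fun w => a * F w) = a * wsum n m F.
Proof.
elim: n m F => [|n IH] m F /=; first by case: ifP; rewrite ?mulr0.
by rewrite mulr_sumr; apply: eq_bigr => c _; rewrite IH mulrCA.
Qed.

Lemma wsum0 n m : wsum n m (fun=> 0) = 0.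
Proof.
rewrite -[RHS](mul0r (wsum n m (fun=> 0))) -wsumZ.
by apply: eq_wsum => w _ _; rewrite mul0r.
Qed.

Lemma wsum_total0 n F : wsum n 0 F = F (nseq n 0%N).
Proof.
by elim: n F => [|n IH] F //=; rewrite big_ord1 /= invr1 mul1r IH.
Qed.

Lemma factS_inv c : (c.+1)%:R * ((c.+1)`!)%:R^-1 = (c`!)%:R^-1 :> R.
Proof. by rewrite factS natrM invfM mulrA divff ?mul1r ?pnatr_eq0. Qed.

Definition moment (g : nat -> R) (w : seq nat) : R :=
  \sum_(p < size w) g p * (nth 0%N w p)%:R.

Lemma moment_cons g c w :
  moment g (c :: w) = g 0%N * c%:R + moment (fun p => g p.+1) w.
Proof. by rewrite /moment /= big_ord_recl. Qed.

Lemma moment_nseq0 g n : moment g (nseq n 0%N) = 0.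
Proof. by rewrite /moment big1 // => p _; rewrite nth_nseq if_same mulr0. Qed.

Lemma moment1 w : moment (fun=> 1) w = (sumn w)%:R.
Proof.
elim: w => [|c w IH]; first by rewrite /moment big_ord0.
by rewrite moment_cons IH mul1r /= natrD.
Qed.

(* Prepending a car that prefers p increments the letter p. With g = 1 this turns
   sums over preference sequences into word sums; with g p = p + 1 it turns the
   first preference into the total of all preferences. *)
Lemma wsum_incr n m (g : nat -> R) F :
  \sum_(p < n) g p * wsum n m (fun w => F (incr_nth w p)) =
  wsum n m.+1 (fun w => moment g w * F w).
Proof.
elim: n m g F => [|n IH] m g F; first by rewrite big_ord0.
rewrite big_ord_recl.
rewrite [RHS](_ : _ = \sum_(c < m.+2) (c`!)%:R^-1 *
   (g 0%N * c%:R * wsum n (m.+1 - c) (fun w => F (val c :: w))) +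
   \sum_(c < m.+2) (c`!)%:R^-1 *
   wsum n (m.+1 - c) (fun w => moment (fun p => g p.+1) w * F (val c :: w)));
   last first.
  rewrite -big_split /=; apply: eq_bigr => c _.
  rewrite -mulrDr -wsumZ -wsumD; congr (_ * _); apply: eq_wsum => w _ _.
  by rewrite moment_cons mulrDl.
congr (_ + _).
  rewrite big_ord_recl /= mulr0 mul0r mulr0 add0r mulr_sumr.
  apply: eq_bigr => c _; rewrite subSS -(factS_inv c).
  by rewrite /bump /= add1n; ring.
rewrite big_ord_recr /= subnn wsum_total0 moment_nseq0 mul0r mulr0 addr0.
under eq_bigr => p _ do rewrite /= mulr_sumr.
rewrite exchange_big /=; apply: eq_bigr => c _.
have lecm : (c <= m)%N by rewrite -ltnS.
rewrite subSn // -IH mulr_sumr; apply: eq_bigr => p _ /=.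
by rewrite mulrCA.
Qed.

Lemma wsum_cons n m F G k :
  (forall c w, (c <= m)%N -> size w = n -> sumn w = (m - c)%N ->
     F (c :: w) = G c w) ->
  (forall c, (c <= m)%N -> wsum n (m - c) (G c) = k c) ->
  wsum n.+1 m F = \sum_(c < m.+1) (c`!)%:R^-1 * k c.
Proof.
move=> FG Gk; apply: eq_bigr => c _; have lec : (c <= m)%N by rewrite -ltnS.
congr (_ * _); rewrite -Gk //; apply: eq_wsum => w sw mw; exact: FG.
Qed.

(* The walk started at h with steps c - 1, c running through w, does not reach 0
   within w. *)
Fixpoint survives (h : nat) (w : seq nat) : bool :=
  match h, w with
  | 0, _ => false
  | _.+1, [::] => true
  | h'.+1, c :: w' => survives (h' + c) w'
  end.

(* The first time this walk has gone down by j. A word is read as followed by one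
   more step down (the extra spot n + 1), hence the value 1 on the empty word. *)
Fixpoint hitting_time (j : nat) (w : seq nat) : nat :=
  match j, w with
  | 0, _ => 0
  | _.+1, [::] => 1
  | j'.+1, c :: w' => (hitting_time (j' + c) w').+1
  end.

Lemma hitting_time0 w : hitting_time 0 w = 0%N. Proof. by case: w. Qed.

(** * Convolution with the exponential series *)

Definition shift (f : nat -> R) (m : nat) : R := if m is m'.+1 then f m' else 0.
(** Sequences are read as coefficients of power series in z: [shift] multiplies by z, [econv] by exp
    z, [epow y] is exp (y z) and [esum y] is exp (y z) / (1 - z). *)
Definition econv (f : nat -> R) (m : nat) : R :=
  \sum_(c < m.+1) (c`!)%:R^-1 * f (m - c)%N.
Definition epow (y : R) (m : nat) : R := y ^+ m / (m`!)%:R.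
Definition esum (y : R) (m : nat) : R := \sum_(l < m.+1) epow y l.

Lemma econv1 f m :
  \sum_(c < m.+1) (c`!)%:R^-1 * (c%:R * f (m - c)%N) = shift (econv f) m.
Proof.
rewrite big_ord_recl /= mul0r mulr0 add0r; case: m => [|m]; first by rewrite big_ord0.
apply: eq_bigr => c _; rewrite /= /bump /= add1n subSS -(factS_inv c).
by ring.
Qed.

(** Coefficientwise, (z d/dz)^2 exp z = (z + z^2) exp z; [econv1] is the first-order case. *)
Lemma econv2 f m :
  \sum_(c < m.+1) (c`!)%:R^-1 * (c%:R * (c%:R * f (m - c)%N)) =
  shift (econv f) m + shift (shift (econv f)) m.
Proof.
rewrite big_ord_recl /= mul0r mulr0 add0r; case: m => [|m].
  by rewrite big_ord0 addr0.
rewrite [shift _ m.+1]/= [shift (shift _) _]/= -econv1 -big_split; apply: eq_bigr => c _ /=.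
rewrite /bump /= add1n subSS -(factS_inv c) -natr1.
by ring.
Qed.

Lemma epow_shift y m : y * shift (epow y) m = m%:R * epow y m.
Proof.
case: m => [|m]; first by rewrite mulr0 mul0r.
by rewrite /= /epow exprS -(factS_inv m); ring.
Qed.

Lemma esum_shift y m : shift (esum y) m = esum y m - epow y m.
Proof.
case: m => [|m]; first by rewrite /esum big_ord1 subrr.
by rewrite /esum /= [in RHS]big_ord_recr /= addrK.
Qed.

Lemma econv_epow y m : econv (epow y) m = epow (y + 1) m.
Proof.
rewrite /epow exprDn mulr_suml; apply: eq_bigr => c _; rewrite expr1n mulr1.
have lec : (c <= m)%N by rewrite -ltnS.
rewrite -mulr_natr -(bin_fact lec) !natrM.
have := pnatr_eq0 R; move=> E.
have f0 k : (k`!)%:R != 0 :> R by rewrite E -lt0n fact_gt0.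
have b0 : ('C(m, c))%:R != 0 :> R by rewrite E -lt0n bin_gt0.
by field; rewrite !f0 b0.
Qed.

(** Multiplication by exp z commutes with division by 1 - z; the induction adds one coefficient of
    [econv_epow] at a time. *)
Lemma econv_esum y m : econv (esum y) m = esum (y + 1) m.
Proof.
elim: m => [|m IH]; first
  by rewrite /econv /esum !big_ord1 /epow !expr0 mul1r fact0 invr1 mulr1.
rewrite /econv big_ord_recr /= subnn.
rewrite [RHS]/esum [RHS]big_ord_recr /= -/(esum (y+1) m) -IH -econv_epow.
rewrite /econv [X in _ = _ + X]big_ord_recr /= subnn addrA -big_split /=.
congr (_ + _); last by rewrite /esum big_ord1.
apply: eq_bigr => c _; have lec : (c <= m)%N by rewrite -ltnS.
by rewrite -mulrDr subSn // /esum [in LHS]big_ord_recr.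
Qed.

Lemma econv_quad a b d f m :
  \sum_(c < m.+1) (c`!)%:R^-1 * ((a + b * c%:R + d * (c%:R * c%:R)) * f (m - c)%N) =
  a * econv f m + b * shift (econv f) m +
  d * (shift (econv f) m + shift (shift (econv f)) m).
Proof.
rewrite -econv2 -econv1 !mulr_sumr -!big_split /=; apply: eq_bigr => c _.
by ring.
Qed.

Lemma eq_shift f g : f =1 g -> shift f =1 shift g.
Proof. by move=> fg [|m] /=. Qed.

Lemma econv_epow_quad a b d y m :
  \sum_(c < m.+1)
    (c`!)%:R^-1 * ((a + b * c%:R + d * (c%:R * c%:R)) * epow y (m - c)%N) =
  a * epow (y + 1) m + b * shift (epow (y + 1)) m +
  d * (shift (epow (y + 1)) m + shift (shift (epow (y + 1))) m).
Proof.
have E := econv_epow y.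
by rewrite econv_quad E (eq_shift E) (eq_shift (eq_shift E)).
Qed.

Lemma econv_esum_quad a b d y m :
  \sum_(c < m.+1)
    (c`!)%:R^-1 * ((a + b * c%:R + d * (c%:R * c%:R)) * esum y (m - c)%N) =
  a * esum (y + 1) m + b * shift (esum (y + 1)) m +
  d * (shift (esum (y + 1)) m + shift (shift (esum (y + 1))) m).
Proof.
have E := econv_esum y.
by rewrite econv_quad E (eq_shift E) (eq_shift (eq_shift E)).
Qed.

Lemma shift2_esum y m :
  shift (shift (esum y)) m = esum y m - epow y m - shift (epow y) m.
Proof.
rewrite (eq_shift (esum_shift y)) -esum_shift.
by case: m => [|m] /=; rewrite ?subr0.
Qed.

Lemma epow_shift2 y m :
  y * shift (shift (epow y)) m = (m%:R - 1) * shift (epow y) m.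
Proof.
case: m => [|m] /=; first by rewrite !mulr0.
by rewrite epow_shift -natr1 addrK.
Qed.

(** * Closed forms for the sums over surviving words *)

Definition position_sum : seq nat -> R := moment (fun p => p.+1%:R).

(** Prepending a letter moves the old preferences one spot to the right, so they gain 1 each, and
    the c new ones are worth 1 each. *)
Lemma position_sum_cons c w : position_sum (c :: w) = (c + sumn w)%:R + position_sum w.
Proof.
rewrite /position_sum moment_cons mul1r natrD -addrA; congr (_ + _).
rewrite -moment1 /moment -big_split; apply: eq_bigr => p _ /=.
by rewrite -mulrDl nat1r.
Qed.

(* In the recursions on the first letter c the spot count M = n + 1 of the
   remaining word does not depend on c, so that only polynomials in c, of degree
   at most 2, multiply epow and esum. *)
Lemma wsum_quad n m (F : seq nat -> R) (G : nat -> seq nat -> R) a b d a' b' d' y :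
  y + 1 != 0 ->
  (forall c w, (c <= m)%N -> size w = n -> sumn w = (m - c)%N ->
     F (c :: w) = G c w) ->
  (forall c, (c <= m)%N -> wsum n (m - c) (G c) =
     (a + b * c%:R + d * (c%:R * c%:R)) * epow y (m - c) +
     (a' + b' * c%:R + d' * (c%:R * c%:R)) * esum y (m - c)) ->
  wsum n.+1 m F =
    (a - b' - 2 * d' + (b + d - d') * m%:R / (y + 1) +
     d * m%:R * (m%:R - 1) / (y + 1) ^+ 2) * epow (y + 1) m +
    (a' + b' + 2 * d') * esum (y + 1) m.
Proof.
move=> y0 FG Gk; rewrite (wsum_cons FG Gk).
under eq_bigr => c _ do rewrite mulrDr.
rewrite big_split /= econv_epow_quad econv_esum_quad shift2_esum esum_shift.
have := epow_shift2 (y + 1) m; have := epow_shift (y + 1) m.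
move: (shift (shift _) m) (shift _ m) (epow _ m) (esum _ m) => r q p e Eq Er.
have -> : r = (m%:R - 1) * q / (y + 1) by rewrite -Er; field.
have -> : q = m%:R * p / (y + 1) by rewrite -Eq; field.
by field.
Qed.

(** Cycle lemma: among words of length n + 1 and total m, of weight (n + 1)^m / m!, the proportion h
    / (n + 1) first brings the walk from h to 0 at the very end. The last letter is then 0 and is
    dropped. *)
Lemma wsum_survives n m h : (h + m = n.+1)%N ->
  wsum n m (fun w => (survives h w)%:R) = h%:R / n.+1%:R * epow n.+1%:R m.
Proof.
elim: n m h => [|n IH] m [|h] hm.
- by rewrite /= mul0r mul0r; case: ifP.
- have [-> ->] : h = 0%N /\ m = 0%N by lia.
  by rewrite /= /epow expr0 fact0 !mul1r invr1 mulr1.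
- by rewrite (@eq_wsum _ _ _ (fun=> 0)) ?wsum0 ?mul0r //; case.
have [y defy] : {y : R | n.+1%:R = y} by exists n.+1%:R.
have Ey : n.+2%:R = y + 1 by rewrite -defy natr1.
have y0 : y != 0 by rewrite -defy pnatr_eq0.
have y10 : y + 1 != 0 by rewrite -Ey pnatr_eq0.
have hmy : h%:R + m%:R = y :> R by rewrite -defy -natrD; congr (_%:R); lia.
rewrite (@wsum_quad _ _ _ (fun c w => (survives (h + c) w)%:R)
  (h%:R / y) y^-1 0 0 0 0 y) //; last first.
  move=> c lec; rewrite IH; last by lia.
  by rewrite natrD defy; field; rewrite ?y0 ?y10.
rewrite Ey -[h.+1%:R]natr1.
have -> : m%:R = y - h%:R :> R by rewrite -hmy; ring.
by field; rewrite ?y0 ?y10.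
Qed.

(** Divided by [wsum_survives], this is the mean j (n + 1) / h: the h successive descents by 1 are
    exchangeable and take n + 1 steps together. *)
Lemma wsum_hitting_time n m h j : (h + m = n.+1)%N -> (j <= h)%N ->
  wsum n m (fun w => (survives h w)%:R * (hitting_time j w)%:R) = j%:R * epow n.+1%:R m.
Proof.
elim: n m h j => [|n IH] m h [|j] hm jh.
1,3: by rewrite (@eq_wsum _ _ _ (fun=> 0)) ?wsum0 ?mul0r // => w;
    rewrite hitting_time0 mulr0.
- have [-> -> ->] : [/\ h = 1%N, j = 0%N & m = 0%N] by split; lia.
  by rewrite /= /epow expr0 fact0; field.
case: h hm jh => // h hm jh.
have [y defy] : {y : R | n.+1%:R = y} by exists n.+1%:R.
have Ey : n.+2%:R = y + 1 by rewrite -defy natr1.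
have y0 : y != 0 by rewrite -defy pnatr_eq0.
have y10 : y + 1 != 0 by rewrite -Ey pnatr_eq0.
have hmy : h%:R + m%:R = y :> R by rewrite -defy -natrD; congr (_%:R); lia.
rewrite (@wsum_quad _ _ _
  (fun c w => (survives (h + c) w)%:R + (survives (h + c) w)%:R * (hitting_time (j + c) w)%:R)
  (h%:R / y + j%:R) (y^-1 + 1) 0 0 0 0 y) //; first last.
- move=> c lec; rewrite wsumD IH; [|lia|lia].
  rewrite wsum_survives; last by lia.
  by rewrite !natrD defy; field; rewrite ?y0 ?y10.
- by move=> c w _ _ _ /=; rewrite -natr1; ring.
rewrite Ey -[j.+1%:R]natr1.
have -> : m%:R = y - h%:R :> R by rewrite -hmy; ring.
by field; rewrite ?y0 ?y10.
Qed.

Lemma wsum_position_sum n m h : (h + m = n.+1)%N ->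
  wsum n m (fun w => (survives h w)%:R * position_sum w) =
  h%:R / 2 * ((m%:R * (n.+1%:R + 1) + n.+1%:R) / n.+1%:R * epow n.+1%:R m
               - esum n.+1%:R m).
Proof.
elim: n m h => [|n IH] m [|h] hm.
- by rewrite /= mul0r mul0r mul0r; case: ifP.
- have [-> ->] : h = 0%N /\ m = 0%N by lia.
  rewrite /= /position_sum /moment /esum big_ord0 big_ord1 /epow expr0 fact0.
  by field.
- by rewrite (@eq_wsum _ _ _ (fun=> 0)) ?wsum0 ?mul0r // => -[|c w] //; rewrite mul0r.
have [y defy] : {y : R | n.+1%:R = y} by exists n.+1%:R.
have Ey : n.+2%:R = y + 1 by rewrite -defy natr1.
have y0 : y != 0 by rewrite -defy pnatr_eq0.
have y10 : y + 1 != 0 by rewrite -Ey pnatr_eq0.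
have hmy : h%:R + m%:R = y :> R by rewrite -defy -natrD; congr (_%:R); lia.
(* The first letter adds m to the total of the preferences. The coefficients expand the closed forms
   at height h + c and total m - c in powers of c. *)
rewrite (@wsum_quad _ _ _
  (fun c w => m%:R * (survives (h + c) w)%:R + (survives (h + c) w)%:R * position_sum w)
  (m%:R * h%:R / y + h%:R / 2 * (m%:R * (y + 1) + y) / y)
  (m%:R / y + (m%:R * (y + 1) + y - h%:R * (y + 1)) / y / 2)
  (- (y + 1) / y / 2) (- h%:R / 2) (- 1 / 2) 0 y) //; first last.
- move=> c lec; rewrite wsumD wsumZ IH; last by lia.
  rewrite wsum_survives; last by lia.
  by rewrite natrB // !natrD defy; field; rewrite ?y0 ?y10.
- move=> c w lec _ mw; rewrite position_sum_cons mw subnKC //=; ring.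
rewrite Ey -[h.+1%:R]natr1.
have -> : m%:R = y - h%:R :> R by rewrite -hmy; ring.
by field; rewrite ?y0 ?y10.
Qed.

Lemma wsum_hitting_time_position_sum n m h j : (h + m = n.+1)%N -> (j <= h)%N ->
  wsum n m (fun w => (survives h w)%:R * (hitting_time j w)%:R * position_sum w) =
  j%:R / 2 *
    ((m%:R * (n.+1%:R + 1) + n.+1%:R - (h%:R - j%:R) * n.+1%:R) * epow n.+1%:R m
     + ((h%:R - j%:R) * h%:R - n.+1%:R) * esum n.+1%:R m).
Proof.
elim: n m h j => [|n IH] m h [|j] hm jh.
1,3: by rewrite (@eq_wsum _ _ _ (fun=> 0)) ?wsum0 ?mul0r // => w;
    rewrite hitting_time0 mulr0 mul0r.
- have [-> -> ->] : [/\ h = 1%N, j = 0%N & m = 0%N] by split; lia.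
  rewrite /= /position_sum /moment /esum big_ord0 big_ord1 /epow expr0 fact0.
  by field.
case: h hm jh => // h hm jh.
have [y defy] : {y : R | n.+1%:R = y} by exists n.+1%:R.
have Ey : n.+2%:R = y + 1 by rewrite -defy natr1.
have y0 : y != 0 by rewrite -defy pnatr_eq0.
have y10 : y + 1 != 0 by rewrite -Ey pnatr_eq0.
have hmy : h%:R + m%:R = y :> R by rewrite -defy -natrD; congr (_%:R); lia.
(* The first letter adds c to both h and j, so h - j is invariant and the degree in c stays at most
   2. *)
pose D : R := h%:R - j%:R.
(* The four terms expand (1 + hitting time) (m + position sum) on the remaining word. *)
rewrite (@wsum_quad _ _ _
  (fun c w => m%:R * (survives (h + c) w)%:R + (survives (h + c) w)%:R * position_sum w +
     m%:R * ((survives (h + c) w)%:R * (hitting_time (j + c) w)%:R) +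
     (survives (h + c) w)%:R * (hitting_time (j + c) w)%:R * position_sum w)
  (m%:R * h%:R / y + h%:R / 2 * (m%:R * (y + 1) + y) / y
    + m%:R * j%:R + j%:R / 2 * (m%:R * (y + 1) + y - D * y))
  (m%:R / y + (m%:R * (y + 1) + y - h%:R * (y + 1)) / y / 2
    + m%:R + (m%:R * (y + 1) + y - D * y - j%:R * (y + 1)) / 2)
  (- (y + 1) / y / 2 - (y + 1) / 2)
  (- h%:R / 2 + j%:R / 2 * (D * h%:R - y))
  (- 1 / 2 + (D * h%:R - y + j%:R * D) / 2) (D / 2) y) //; first last.
- move=> c lec; rewrite !wsumD !wsumZ IH; [|lia|lia].
  rewrite wsum_survives ?wsum_hitting_time ?wsum_position_sum; try lia.
  by rewrite natrB // !natrD defy /D; field; rewrite ?y0 ?y10.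
- move=> c w lec _ mw; rewrite position_sum_cons mw subnKC //= -natr1; ring.
rewrite Ey -[h.+1%:R]natr1 -[j.+1%:R]natr1 /D.
have -> : m%:R = y - h%:R :> R by rewrite -hmy; ring.
by field; rewrite ?y0 ?y10.
Qed.

End WordSums.

(** * Parking as a sweep of the street *)

(* Sweeping the street from the left with o cars carried over from the previous
   spots: a spot is occupied iff a car is carried to it or prefers it. *)
Fixpoint sweep (o : nat) (w : seq nat) : seq bool :=
  if w is c :: w' then (0 < o + c)%N :: sweep (o + c).-1 w' else [::].

Fixpoint overflow (o : nat) (w : seq nat) : nat :=
  if w is c :: w' then overflow (o + c).-1 w' else o.

Lemma size_sweep o w : size (sweep o w) = size w.
Proof. by elim: w o => //= c w IH o; rewrite IH. Qed.

(** * Effect of one more car on the sweep *)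

Definition parks_at (p s : nat) (b b' : seq bool) : Prop :=
  [/\ (p <= s < size b)%N, nth false b s = false,
      forall x, (p <= x < s)%N -> nth false b x & b' = set_nth false b s true].

Variant car_added (p : nat) (b : seq bool) (v : nat) : seq bool -> nat -> Prop :=
| CarParks s b' of parks_at p s b b' : car_added p b v b' v
| CarLeaves of (forall x, (p <= x < size b)%N -> nth false b x) :
    car_added p b v b v.+1.

Lemma car_added_cons a p b v b' v' :
  car_added p b v b' v' -> car_added p.+1 (a :: b) v (a :: b') v'.
Proof.
case=> [s {}b' [ps bs full ->]|full].
  by apply: (@CarParks _ _ _ s.+1); split => // -[|x] // /full.
by apply: CarLeaves => -[|x] // /full.
Qed.

Lemma car_added_true b v b' v' :
  car_added 0 b v b' v' -> car_added 0 (true :: b) v (true :: b') v'.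
Proof.
case=> [s {}b' [ps bs full ->]|full].
  by apply: (@CarParks _ _ _ s.+1); split => // -[|x] // /full.
by apply: CarLeaves => -[|x] // /full.
Qed.

Lemma car_added_carry o w :
  car_added 0 (sweep o w) (overflow o w) (sweep o.+1 w) (overflow o.+1 w).
Proof.
elim: w o => [|c w IH] o /=; first by apply: CarLeaves => x; rewrite ltn0 andbF.
rewrite addSn /=; case: (o + c)%N => [|k] /=.
  by apply: (@CarParks _ _ _ 0) ; split.
exact: car_added_true.
Qed.

(** Occupancy does not depend on the order of the cars: a car added to the counts may be treated as
    the last to enter. Preferring the first spot amounts to being carried into it. *)
Lemma car_added_incr o w p : (p < size w)%N ->
  car_added p (sweep o w) (overflow o w) (sweep o (incr_nth w p)) (overflow o (incr_nth w p)).
Proof.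
elim: w o p => [|c w IH] o [|p] //= lep.
  rewrite addnS /=; have := car_added_carry o (c :: w).
  by rewrite /= !addSn /=.
exact/car_added_cons/IH.
Qed.

Lemma size_incr_nth_lt (w : seq nat) p : (p < size w)%N ->
  size (incr_nth w p) = size w.
Proof. by move=> lep; rewrite size_incr_nth lep. Qed.

(** * Agreement of the parking process with the sweep *)

Section Link.
Variable n : nat.
Implicit Types (p s : 'I_n) (prefs : seq 'I_n) (w : seq nat).

Definition occset w : {set 'I_n} := [set s : 'I_n | nth false (sweep 0 w) s]%SET.

(** The list of free spots from p on is strictly increasing, so a head other than s would be a free
    spot below s. *)
Lemma parking_spot_some (occ : {set 'I_n}) p s :
  (p <= s)%N -> s \notin occ ->
  (forall x : 'I_n, (p <= x < s)%N -> x \in occ) ->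
  parking_spot occ p = Some s.
Proof.
move=> ps sf full; rewrite /parking_spot.
have ltI_trans : transitive (fun x y : 'I_n => (x < y)%N).
  by move=> x y z; apply: ltn_trans.
set l := seq.filter _ _.
have sl : s \in l by rewrite mem_filter ps sf mem_enum.
have : sorted (fun x y : 'I_n => (x < y)%N) l.
  apply: sorted_filter => //.
  by have := iota_ltn_sorted 0 n; rewrite -val_enum_ord sorted_map.
have : all (fun x : 'I_n => (p <= x)%N && (x \notin occ)) l by apply: filter_all.
case: l sl => // x l; rewrite inE => /orP[/eqP -> //|sl] /= /andP[/andP[px xf] _].
rewrite (path_sortedE ltI_trans) => /andP[/allP /(_ _ sl) xs _].
by rewrite full ?px in xf.
Qed.

Lemma parking_spot_none (occ : {set 'I_n}) p :
  (forall x : 'I_n, (p <= x)%N -> x \in occ) -> parking_spot occ p = None.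
Proof.
move=> full; rewrite /parking_spot (eq_filter (a2 := pred0)) ?filter_pred0 //.
by move=> x /=; case: leqP => // /full ->.
Qed.

(** Cars enter one at a time through [car_added_incr]. The overflow never decreases, so it is the
    same at both ends exactly when every car parks. *)
Lemma park_sweep prefs w : size w = n ->
  let w' := foldl (fun w p => incr_nth w (val p)) w prefs in
  [/\ (overflow 0 w <= overflow 0 w')%N,
      all isSome (park (occset w) prefs) = (overflow 0 w' == overflow 0 w) &
      overflow 0 w' = overflow 0 w -> forall s,
        (s \in occset w') = (s \in occset w) ||
        has (fun po => attempts po.1 po.2 s) (zip prefs (park (occset w) prefs))].
Proof.
elim: prefs w => [|p prefs IH] w sw /=.
  by split=> [|/[!eqxx]|_ s] //; rewrite orbF.
have pw : (p < size w)%N by rewrite sw.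
have := IH (incr_nth w p); rewrite size_incr_nth_lt // => /(_ sw).
set w1 := incr_nth w p; set w2 := foldl _ _ _ => -[le12 all12 att].
have : car_added p (sweep 0 w) (overflow 0 w) (sweep 0 w1) (overflow 0 w1).
  exact: car_added_incr.
move E1: (sweep 0 w1) => b1; move E2: (overflow 0 w1) => v1 added.
(* If the car leaves, the overflow has grown for good, which settles the last two claims. *)
case: added E1 E2 => [s {}b1 [/andP[ps sb] bs full ->]|full] E1 E2; last first.
  rewrite parking_spot_none => [/=|x px]; last first.
    by rewrite inE full // px size_sweep sw ltn_ord.
  rewrite E2 in le12; split; first exact: ltnW.
    by apply/esym/negbTE; rewrite neq_ltn le12 orbT.
  by move=> E; rewrite E ltnn in le12.
rewrite size_sweep sw in sb; pose s0 := Ordinal sb.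
have occ1 : occset w1 = (s0 |: occset w)%SET.
  by apply/setP => x; rewrite !inE E1 nth_set_nth /= -val_eqE /=; case: eqP.
rewrite (parking_spot_some (s := s0)) //; last first.
- by move=> x px; rewrite inE full.
- by rewrite inE /= bs.
rewrite /= -occ1 -E2; split=> // ovf12 x.
(* Apart from the spot it takes, the car attempts only spots already occupied. *)
rewrite att ?ovf12 ?E2 // orbA; congr (_ || _).
rewrite occ1 /attempts !inE -val_eqE /=.
have [-> | xs] := eqVneq (val x) s; first by rewrite ps leqnn orbT.
case: (boolP (p <= x)%N) => px; rewrite ?orbF //=.
case: leqP => xs'; rewrite ?orbF // orbT full //.
by rewrite px ltn_neqAle xs.
Qed.

End Link.

(** * Empty spots and the walk *)

Definition empties (b : seq bool) : seq nat :=
  [seq x.+1 | x <- iota 0 (size b) & ~~ nth false b x].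

Lemma empties_cons a b :
  empties (a :: b) =
  if a then map succn (empties b) else 1%N :: map succn (empties b).
Proof.
rewrite /empties /= -[1%N]addn0 iotaDl filter_map -map_comp.
by case: a; rewrite /= -!map_comp.
Qed.

(** Conservation of cars: each nonempty spot holds one of the [o + sumn w] cars, and the others
    overflow. *)
Lemma size_empties o w :
  (size (empties (sweep o w)) + (o + sumn w) = size w + overflow o w)%N.
Proof.
elim: w o => [|c w IH] o; first by rewrite /= addn0.
have := IH (o + c).-1; rewrite [sweep _ _]/= empties_cons /=.
rewrite [(o + (c + _))%N]addnA.
by case: (o + c)%N => [|k] /=; rewrite !size_map; lia.
Qed.

(** By the hypothesis, h - 1 is the number of spots left minus the number of cars preferring them.
    The walk reaches 0 when some suffix of the street is preferred by more cars than it has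
    spots. *)
Lemma overflow_survives o w h : (h + sumn w = (size w).+1)%N -> (o < h)%N ->
  (overflow o w == 0%N) = survives h w.
Proof.
elim: w o h => [|c w IH] o [|h] //=; first by rewrite addn0 => -[->]; case: o.
move=> hw oh; have [hc|hc] := ltnP (o + c).-1 (h + c).
  by apply: IH => //; lia.
(* With h already lowered by 1, the bound on carried cars fails only here, and then the rest of the
   word has one more car than spots. *)
have hc0 : (h + c = 0)%N by lia.
rewrite hc0 (_ : survives 0 w = false); last by case: (w).
have := size_empties (o + c).-1 w.
by case: (overflow _ _) => [|v] //; lia.
Qed.

(** The carried load is the walk reflected at 0; each empty spot is a new record low of the
    unreflected walk, the first one after a descent by o + 1. *)
Lemma nth_empties o w i : (i < size (empties (sweep o w)))%N ->
  nth 0%N (empties (sweep o w)) i = hitting_time (o + i.+1) w.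
Proof.
elim: w o i => [|c w IH] o i //; rewrite [sweep _ _]/= empties_cons addnS /=.
have -> : (o + i + c = o + c + i)%N by rewrite addnAC.
case: (o + c)%N => [|k] /=; rewrite (size_map succn (empties _)).
  by case: i => [|i] /=; rewrite ?hitting_time0 // => lei; rewrite (nth_map 0%N 0%N succn) // IH.
by move=> lei; rewrite (nth_map 0%N 0%N succn) // IH // addSnnS.
Qed.

Lemma sumn_incr_nth w p : sumn (incr_nth w p) = (sumn w).+1.
Proof.
elim: p w => [|p IH] [|c w] //=; last by rewrite IH addnS.
by rewrite sumn_ncons mul0n.
Qed.

(** * From preference sequences to words *)

Section Counts.
Variable n : nat.

Definition counts (prefs : seq 'I_n) : seq nat :=
  foldl (fun w p => incr_nth w (val p)) (nseq n 0%N) prefs.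

Lemma foldl_incr w (p : 'I_n) (prefs : seq 'I_n) :
  foldl (fun w p => incr_nth w (val p)) (incr_nth w p) prefs =
  incr_nth (foldl (fun w p => incr_nth w (val p)) w prefs) p.
Proof. by elim: prefs w => //= q prefs IH w; rewrite incr_nthC IH. Qed.

Lemma counts_cons p prefs : counts (p :: prefs) = incr_nth (counts prefs) p.
Proof. exact: foldl_incr. Qed.

Lemma size_counts prefs : size (counts prefs) = n.
Proof.
elim: prefs => [|p prefs IH]; first exact: size_nseq.
by rewrite counts_cons size_incr_nth_lt // IH.
Qed.

Lemma sumn_counts prefs : sumn (counts prefs) = size prefs.
Proof.
elim: prefs => [|p prefs IH]; first by rewrite /counts sumn_nseq mul0n.
by rewrite counts_cons sumn_incr_nth IH.
Qed.

Lemma sweep_nseq0 k : sweep 0 (nseq k 0%N) = nseq k false.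
Proof. by elim: k => //= k ->. Qed.

Lemma overflow_nseq0 k : overflow 0 (nseq k 0%N) = 0%N.
Proof. by elim: k. Qed.

Lemma occset_nseq0 : occset n (nseq n 0%N) = finset.set0.
Proof. by apply/setP => s; rewrite !inE sweep_nseq0 nth_nseq if_same. Qed.

Lemma is_parking_function_counts prefs :
  is_parking_function prefs = (overflow 0 (counts prefs) == 0%N).
Proof.
have [_ H _] := park_sweep prefs (size_nseq n 0%N).
by rewrite occset_nseq0 overflow_nseq0 in H.
Qed.

Lemma unattempted_counts prefs : is_parking_function prefs ->
  [seq spot_number s | s <- unattempted prefs] = empties (sweep 0 (counts prefs)).
Proof.
rewrite is_parking_function_counts => /eqP pf.
have [_ _] := park_sweep prefs (size_nseq n 0%N).
rewrite occset_nseq0 overflow_nseq0 => /(_ pf) att.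
rewrite /empties size_sweep size_counts -val_enum_ord filter_map -map_comp.
rewrite /unattempted; congr map; apply: eq_filter => s /=.
by have := att s; rewrite !inE /= -/(counts prefs) => ->.
Qed.

Lemma parking_survives m prefs : (m <= n)%N -> size prefs = m ->
  is_parking_function prefs = survives (n.+1 - m) (counts prefs).
Proof.
move=> lemn sp; rewrite is_parking_function_counts; apply: overflow_survives; last by lia.
by rewrite sumn_counts size_counts sp; lia.
Qed.

Lemma unattempted_spot_hitting_time m i prefs : (0 < i)%N -> (i + m <= n)%N -> size prefs = m ->
  is_parking_function prefs -> unattempted_spot i prefs = hitting_time i (counts prefs).
Proof.
case: i => // i _ imn sp pf; rewrite /unattempted_spot unattempted_counts //=.
rewrite nth_empties //; have := size_empties 0 (counts prefs).
move: pf; rewrite is_parking_function_counts => /eqP ->.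
by rewrite sumn_counts size_counts sp; lia.
Qed.

End Counts.

Section Sums.
Variable R : numFieldType.

Lemma big_tuple_cons (T : finType) m (f : m.+1.-tuple T -> R) :
  \sum_(t : m.+1.-tuple T) f t =
  \sum_(p : T) \sum_(t : m.-tuple T) f [tuple of p :: t].
Proof.
rewrite pair_bigA /=.
rewrite (reindex (fun pt : T * m.-tuple T => [tuple of pt.1 :: pt.2])) //=.
exists (fun t => (thead t, [tuple of behead t])).
  by move=> [p t] _ /=; congr (_, _); apply: val_inj.
by move=> t _; rewrite [RHS]tuple_eta.
Qed.

Lemma sum_counts n m (F : seq nat -> R) :
  \sum_(t : m.-tuple 'I_n) F (counts t) = (m`!)%:R * wsum n m F.
Proof.
elim: m F => [|m IH] F.
  rewrite wsum_total0 fact0 mul1r (big_pred1 [tuple]) //.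
  by move=> t; apply/esym/eqP; exact: tuple0.
rewrite big_tuple_cons.
under eq_bigr => p _.
  under eq_bigr => t _ do rewrite counts_cons.
  rewrite (IH (fun w => F (incr_nth w p))); over.
rewrite -mulr_sumr.
have := wsum_incr n m (fun=> 1) F.
under eq_bigr do rewrite mul1r.
(* The moment of weight 1 is the number m + 1 of cars, which turns m! into (m + 1)!. *)
move=> ->; rewrite (@eq_wsum _ _ _ _ (fun w => m.+1%:R * F w)); last first.
  by move=> w _ sw; rewrite moment1 sw.
by rewrite wsumZ mulrA -natrM mulnC -factS.
Qed.

(** All cars play the same role in [counts], so the first preference stands for a share 1 / (m + 1)
    of the total; hence m! in place of (m + 1)!. *)
Lemma sum_preference n m (F : seq nat -> R) :
  \sum_(t : m.+1.-tuple 'I_n) (preference 1 t)%:R * F (counts t) =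
  (m`!)%:R * wsum n m.+1 (fun w => position_sum R w * F w).
Proof.
rewrite big_tuple_cons -wsum_incr mulr_sumr; apply: eq_bigr => p _.
rewrite /preference /= /spot_number -mulr_sumr mulrCA; congr (_ * _).
by rewrite -sum_counts; apply: eq_bigr => t _; rewrite counts_cons.
Qed.

End Sums.

(** * The covariance *)

Section Cov.
Variable R : realType.

Lemma ucovarianceE (T : finType) (A : {set T}) (X Y : T -> R) :
  #|A|%:R != 0 :> R ->
  ucovariance A X Y =
  (\sum_(x in A) X x * Y x) / #|A|%:R -
  (\sum_(x in A) X x) / #|A|%:R * ((\sum_(x in A) Y x) / #|A|%:R).
Proof.
move=> A0; rewrite /ucovariance /uexpectation.
set b := (\sum_(x in A) X x) / _.
set d := (\sum_(x in A) Y x) / _.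
rewrite (eq_bigr (fun x => X x * Y x + (- d * X x + (- b * Y x + b * d)))); last first.
  by move=> x _; ring.
rewrite !big_split /= -!mulr_sumr sumr_const -mulr_natr /d /b.
by field.
Qed.

Lemma sum_PF (n m : nat) (f : m.-tuple 'I_n -> R) : (m <= n)%N ->
  \sum_(t in PF m n) f t =
  \sum_(t : m.-tuple 'I_n) (survives (n.+1 - m) (counts t))%:R * f t.
Proof.
move=> lemn; rewrite big_mkcond; apply: eq_bigr => t _.
rewrite inE (parking_survives lemn (size_tuple t)).
by case: survives; rewrite ?mul1r ?mul0r.
Qed.

(* The sum of m (m - 1) ... (m - k + 1) / M^k over k. *)
Definition ramanujanQ (M : R) (m : nat) : R := esum M m / epow M m.

Lemma cov_preference_unattemptedE (i m n : nat) :
  (0 < i)%N -> (0 < m)%N -> (i + m <= n)%N ->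
  let M : R := n.+1%:R in let N := M - m%:R in
  cov_preference_unattempted R i m n =
  - (i%:R * (N - i%:R) * M * (M - N * ramanujanQ M m)) / (2 * N * m%:R).
Proof.
case: m => // m i0 _ imn M N.
have lemn : (m.+1 <= n)%N by lia.
set h := (n.+1 - m.+1)%N; have hm : (h + m.+1 = n.+1)%N by rewrite subnK // leqW.
have ih : (i <= h)%N by lia.
have EN : N = h%:R by rewrite /N /M -hm natrD addrK.
have m0 : m.+1%:R != 0 :> R by rewrite pnatr_eq0.
have N0 : N != 0 by rewrite EN pnatr_eq0 -lt0n (leq_trans i0).
have M0 : M != 0 by rewrite /M pnatr_eq0.
have f0 : (m`!)%:R != 0 :> R by rewrite pnatr_eq0 -lt0n fact_gt0.
have p0 : epow M m.+1 != 0.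
  by rewrite /epow mulf_neq0 ?expf_neq0 // invr_neq0 // pnatr_eq0 -lt0n fact_gt0.
have fE : (m.+1`!)%:R = m.+1%:R * (m`!)%:R :> R by rewrite factS natrM.
have sA : #|PF m.+1 n|%:R = (m.+1`!)%:R * (N / M * epow M m.+1).
  rewrite EN -(wsum_survives R hm) -sum_counts -sum1_card natr_sum sum_PF //.
  by apply: eq_bigr => t _; rewrite mulr1.
have A0 : #|PF m.+1 n|%:R != 0 :> R.
  rewrite sA fE; apply: mulf_neq0; first exact: mulf_neq0.
  by apply: mulf_neq0 => //; apply: mulf_neq0; rewrite ?invr_neq0.
have tauE (t : m.+1.-tuple 'I_n) : t \in PF m.+1 n ->
  (unattempted_spot i t)%:R = (hitting_time i (counts t))%:R :> R.
  by rewrite inE => pf; rewrite (unattempted_spot_hitting_time i0 imn (size_tuple t)).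
have sY : \sum_(t in PF m.+1 n) (unattempted_spot i t)%:R =
    (m.+1`!)%:R * (i%:R * epow M m.+1).
  by rewrite (eq_bigr _ tauE) sum_PF // -(wsum_hitting_time R hm ih) -sum_counts.
have sX : \sum_(t in PF m.+1 n) (preference 1 t)%:R =
    (m`!)%:R * (N / 2 * ((m.+1%:R * (M + 1) + M) / M * epow M m.+1 - esum M m.+1)).
  rewrite EN -(wsum_position_sum R hm) sum_PF //.
  under eq_bigr do rewrite mulrC.
  rewrite (sum_preference _ _ (fun w => (survives h w)%:R)); congr (_ * _).
  by apply: eq_wsum => w _ _; rewrite mulrC.
have sXY : \sum_(t in PF m.+1 n)
      (preference 1 t)%:R * (unattempted_spot i t)%:R =
    (m`!)%:R * (i%:R / 2 *
    ((m.+1%:R * (M + 1) + M - (N - i%:R) * M) * epow M m.+1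
     + ((N - i%:R) * N - M) * esum M m.+1)).
  rewrite EN -(wsum_hitting_time_position_sum R hm ih).
  rewrite (eq_bigr (fun t : m.+1.-tuple 'I_n =>
    (preference 1 t)%:R * (hitting_time i (counts t))%:R)); last first.
    by move=> t /tauE ->.
  rewrite sum_PF //; under eq_bigr do rewrite mulrCA.
  rewrite (sum_preference _ _ (fun w => (survives h w)%:R * (hitting_time i w)%:R)).
  by congr (_ * _); apply: eq_wsum => w _ _; rewrite mulrC.
rewrite /cov_preference_unattempted ucovarianceE // sXY sX sY sA fE /ramanujanQ.
(* Writing the number of cars as M - N leaves a rational identity in independent variables. *)
have -> : m.+1%:R = M - N by rewrite /N subKr.
have MN0 : M - N != 0 by rewrite /N subKr.
clearbody M; move: (epow _ _) p0 (esum _ _) => p p0 e.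
move: (m`!%:R) f0 => f f0.
clear -f0 p0 N0 M0 MN0; clearbody N.
by field; rewrite ?p0 ?f0 ?N0 ?M0 ?MN0.
Qed.

(** * Recursions for [ramanujanQ] and [defect] *)

Lemma ramanujanQS (M : R) m : M != 0 ->
  ramanujanQ M m.+1 = 1 + m.+1%:R / M * ramanujanQ M m.
Proof.
move=> M0.
have f0 k : (k`!)%:R != 0 :> R by rewrite pnatr_eq0 -lt0n fact_gt0.
have p0 k : epow M k != 0.
  by apply: mulf_neq0; rewrite ?invr_neq0 ?f0 ?expf_neq0.
have E := epow_shift M m.+1; rewrite /= in E.
rewrite /ramanujanQ {1}/esum big_ord_recr /= -/(esum M m).
have m0 : m.+1%:R != 0 :> R by rewrite pnatr_eq0.
have := p0 m; move: (epow M m.+1) (epow M m) (m.+1%:R) m0 E => q p a a0 E p0m.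
have -> : q = M * p / a by rewrite E mulrAC divff ?mul1r.
by field; rewrite a0 M0 p0m.
Qed.

(** The quantity r of the exact formula, its only factor whose limit is not immediate. *)
Definition defect (M : R) (m : nat) : R := M - (M - m%:R) * ramanujanQ M m.

Lemma ramanujanQ0 M : ramanujanQ M 0 = 1.
Proof.
by rewrite /ramanujanQ /esum big_ord1 divff // /epow expr0 fact0 divr1 oner_neq0.
Qed.

Lemma defect0 M : defect M 0 = 0.
Proof. by rewrite /defect ramanujanQ0 subr0 mulr1 subrr. Qed.

Lemma defectS M m : 0 < M -> m.+1%:R <= M ->
  defect M m.+1 = m.+1%:R / (M - m%:R) *
    (1 + (1 - m.+1%:R / M) * defect M m).
Proof.
move=> M0 mM; have Mn0 : M != 0 by rewrite gt_eqF.
have Nn0 : M - m%:R != 0.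
  by rewrite gt_eqF // subr_gt0; apply: lt_le_trans mM; rewrite ltr_nat.
rewrite /defect ramanujanQS // -natr1.
move: (ramanujanQ M m) => q.
by field; rewrite ?Mn0 ?Nn0.
Qed.

End Cov.

(** * Two-sided bounds on [defect] *)

Section Bounds.
Variable R : realType.
Implicit Types (x u e r K M c : R).

(** With x = 1 - u and f x = x / (1 - x)^2, one step of the recursion sends the bound f (x - e) to a
    value at most f x: the formal limit is a supersolution. *)
Lemma step_ub u e r : 0 < e -> 0 < u -> u <= 1 ->
  r <= (1 - u - e) / (u + e) ^+ 2 ->
  (1 - u) / (u + e) * (1 + u * r) <= (1 - u) / u ^+ 2.
Proof.
move=> e0 u0 u1 hr; have ue0 : 0 < u + e by rewrite addr_gt0.
rewrite -mulrA ler_wpM2l ?subr_ge0 // mulrC ler_pdivrMr //.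
have hur : u * r <= u * ((1 - u - e) / (u + e) ^+ 2) by rewrite ler_wpM2l // ltW.
apply: le_trans (_ : 1 + u * ((1 - u - e) / (u + e) ^+ 2) <= _).
  by rewrite lerD2l.
rewrite -subr_ge0.
have -> : (u ^+ 2)^-1 * (u + e) - (1 + u * ((1 - u - e) / (u + e) ^+ 2)) =
   ((u + e) ^+ 3 - u ^+ 2 * (u + u * e + e ^+ 2)) / (u ^+ 2 * (u + e) ^+ 2).
  by field; rewrite ?lt0r_neq0.
apply: divr_ge0; last by rewrite mulr_ge0 ?exprn_ge0 ?ltW.
have -> : (u + e) ^+ 3 - u ^+ 2 * (u + u * e + e ^+ 2) =
  u ^+ 2 * e * (1 - u) + 2 * u ^+ 2 * e + u * e ^+ 2 * (1 - u)
  + 2 * u * e ^+ 2 + e ^+ 3 by ring.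
have u1' : 0 <= 1 - u by rewrite subr_ge0.
by rewrite !addr_ge0 ?mulr_ge0 ?exprn_ge0 // ltW.
Qed.

(** The formal limit lowered by K e is a subsolution: the loss in one step is absorbed once K u^4 >=
    3. *)
Lemma step_lb u e r K : 0 < e -> 0 < u -> u <= 1 -> 3 <= K * u ^+ 4 ->
  (1 - u - e) / (u + e) ^+ 2 - K * e <= r ->
  (1 - u) / u ^+ 2 - K * e <= (1 - u) / (u + e) * (1 + u * r).
Proof.
move=> e0 u0 u1 hK hr; have ue0 : 0 < u + e by rewrite addr_gt0.
have un : u != 0 by rewrite gt_eqF. have uen : u + e != 0 by rewrite gt_eqF.
have u1' : 0 <= 1 - u by rewrite subr_ge0.
have K0 : 0 <= K.
  have u40 : 0 < u ^+ 4 by rewrite exprn_gt0.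
  by rewrite -(pmulr_lge0 _ u40); lra.
have x0 : 0 <= (1 - u) / (u + e) by rewrite divr_ge0 // ltW.
have hur : u * ((1 - u - e) / (u + e) ^+ 2 - K * e) <= u * r.
  by rewrite ler_wpM2l // ltW.
have hx : (1 - u) / (u + e) * (1 + u * ((1 - u - e) / (u + e) ^+ 2 - K * e)) <=
   (1 - u) / (u + e) * (1 + u * r) by rewrite ler_wpM2l // lerD2l.
apply: le_trans hx; rewrite -subr_ge0.
(* All four terms are nonnegative; the size of K matters for the last one. *)
have -> : (1 - u) / (u + e) * (1 + u * ((1 - u - e) / (u + e) ^+ 2 - K * e)) -
  ((1 - u) / u ^+ 2 - K * e) =
  (1 - u) * e * (u + e) / (u + e) ^+ 3 +
  (1 - u) * e ^+ 2 * (6 * u ^+ 2 + 8 * u * e + 3 * e ^+ 2) / (u ^+ 3 * (u + e) ^+ 3)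
  + K * e * (1 - u) * e / (u + e)
  + e / u ^+ 3 * (K * u ^+ 4 - 3 * (1 - u)).
  by field; rewrite un uen.
have t1 : 0 <= (K * u ^+ 4 - 3 * (1 - u)) by lra.
have [e0' u0' ue0'] : [/\ 0 <= e, 0 <= u & 0 <= u + e] by split; apply: ltW.
move: (K * u ^+ 4 - 3 * (1 - u)) t1 => t t0.
move: (1 - u) (u + e) u1' ue0' => v w v0 w0.
by rewrite !addr_ge0 ?mulr_ge0 ?invr_ge0 ?addr_ge0 ?mulr_ge0 ?exprn_ge0 ?ler0n.
Qed.

Lemma defect_step M m : 0 < M -> m.+1%:R < M ->
  let u := 1 - m.+1%:R / M in let e := M^-1 in
  [/\ 0 < u, u <= 1, 1 - u = m.+1%:R / M,
    (1 - u - e) / (u + e) ^+ 2 = (m%:R / M) / (1 - m%:R / M) ^+ 2 &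
  defect M m.+1 = (1 - u) / (u + e) * (1 + u * defect M m)].
Proof.
move=> M0 mM u e; have Mn : M != 0 by rewrite gt_eqF.
have mn : M - m%:R != 0.
  by rewrite gt_eqF // subr_gt0; apply: lt_trans mM; rewrite ltr_nat.
split.
- by rewrite subr_gt0 ltr_pdivrMr // mul1r.
- by rewrite gerBl divr_ge0 // ltW.
- by rewrite subKr.
- rewrite /u /e -natr1; congr (_ / _ ^+ 2); ring.
- rewrite defectS ?(ltW mM) // /u /e -natr1.
  rewrite subKr; move: (defect M m) => d; move: m%:R mn => a mn.
  have -> : 1 - (a + 1) / M + M^-1 = (M - a) / M by field.
  by field; rewrite ?Mn ?mn.
Qed.

Lemma defect_le M m : 0 < M -> m%:R < M ->
  defect M m <= (m%:R / M) / (1 - m%:R / M) ^+ 2.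
Proof.
move=> M0; elim: m => [|m IH] mM; first by rewrite defect0 mul0r mul0r.
have [u0 u1 uE eE ->] := defect_step M0 mM.
move: (1 - m.+1%:R / M) u0 u1 uE eE => u u0 u1 <- eE.
apply: step_ub; rewrite ?invr_gt0 //.
rewrite eE; apply: IH; apply: lt_trans mM; by rewrite ltr_nat.
Qed.

Lemma defect_ge M m c : 0 < M -> 0 < c -> c < 1 -> m%:R <= c * M ->
  (m%:R / M) / (1 - m%:R / M) ^+ 2 - 3 / (1 - c) ^+ 4 * M^-1 <= defect M m.
Proof.
move=> M0 c0 c1; elim: m => [|m IH] mM.
  rewrite defect0 mul0r mul0r sub0r oppr_le0.
  by rewrite !mulr_ge0 ?invr_ge0 ?exprn_ge0 ?subr_ge0 ?ltW.
have mM' : m.+1%:R < M by apply: le_lt_trans mM _; rewrite gtr_pMl.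
have [u0 u1 uE eE ->] := defect_step M0 mM'.
(* Since m + 1 <= c M, u stays at least 1 - c, so K = 3 / (1 - c)^4 satisfies 3 <= K u^4. *)
have cu : 1 - c <= 1 - m.+1%:R / M by rewrite lerD2l lerN2 ler_pdivrMr.
move: (1 - m.+1%:R / M) u0 u1 uE eE cu => u u0 u1 <- eE cu.
apply: step_lb; rewrite ?invr_gt0 //.
  rewrite mulrAC ler_pdivlMr; last by rewrite exprn_gt0 // subr_gt0.
  rewrite ler_wpM2l // lerXn2r ?nnegrE ?subr_ge0 ?(ltW c1) //.
  exact: ltW.
rewrite eE; apply: IH; apply: le_trans mM; by rewrite ler_nat.
Qed.

End Bounds.

(** * Passage to the limit *)

Section Limit.
Variable R : realType.
Implicit Types (c a K s t : R).

(* The ratio of the covariance to its limit, as a function of s = 1 / (n + 1), with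
   M - N Q(M, m) replaced by its limit up to an error K s. *)
Definition cov_ratio c a K s : R :=
  (1 - c) ^+ 2 * (1 - a * s / (1 - c * (1 - s))) / (c * (1 - s)) *
  (c * (1 - s) / (1 - c * (1 - s)) ^+ 2 - K * s).

Lemma cvg_cov_ratio c a K : 0 < c -> c < 1 ->
  cov_ratio c a K (harmonic n) @[n --> \oo] --> (1 : R).
Proof.
move=> c0 c1; have hs : harmonic n @[n --> \oo] --> (0 : R) by exact: cvg_harmonic.
have c1n : 1 - c != 0 by rewrite subr_eq0 eq_sym lt_eqF.
have cn : c != 0 by rewrite gt_eqF.
have hx : c * (1 - harmonic n) @[n --> \oo] --> c * (1 - 0).
  by apply: cvgMr; apply: cvgB => //; exact: cvg_cst.
have hu : 1 - c * (1 - harmonic n) @[n --> \oo] --> 1 - c * (1 - 0).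
  by apply: cvgB => //; exact: cvg_cst.
have -> : 1 = cov_ratio c a K 0 :> R.
  by rewrite /cov_ratio subr0 !mulr0 mul0r !subr0 !mulr1; field; rewrite cn c1n.
have xn : c * (1 - 0) != 0 by rewrite subr0 mulr1.
have un : 1 - c * (1 - 0) != 0 by rewrite subr0 mulr1.
apply: cvgM; first apply: cvgM; last apply: cvgB.
- apply: cvgMr; apply: cvgB; first exact: cvg_cst.
  by apply: cvgM; [apply: cvgMr|apply: cvgV].
- exact: cvgV.
- apply: cvgM => //; apply: cvgV; first by rewrite expf_neq0.
  exact: (cvgM hu hu).
- exact: cvgMr.
Qed.

Lemma cov_ratioE c (i m n : nat) d K : 0 < c -> c < 1 -> (0 < i)%N -> (0 < n)%N ->
  m%:R = c * n%:R ->
  let M : R := n.+1%:R in let N := M - m%:R in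
  d = (m%:R / M) / (1 - m%:R / M) ^+ 2 - K * M^-1 ->
  - (i%:R * (N - i%:R) * M * d) / (2 * N * m%:R) / (- (i%:R / (2 * (1 - c) ^+ 2)))
   = cov_ratio c i%:R K (harmonic n).
Proof.
move=> c0 c1 i0 n0 mE M N ->.
have c1n : 1 - c != 0 by rewrite subr_eq0 eq_sym lt_eqF.
have cn : c != 0 by rewrite gt_eqF.
have nn : n%:R != 0 :> R by rewrite pnatr_eq0 -lt0n.
have In : i%:R != 0 :> R by rewrite pnatr_eq0 -lt0n.
have M0 : M != 0 by rewrite /M pnatr_eq0.
have N0 : N != 0.
  rewrite /N /M mE -natr1 gt_eqF // addrAC ltr_pwDr ?ltr01 //.
  by rewrite subr_ge0 ger_pMl ?ltW // ltr0n.
rewrite /cov_ratio /harmonic /= -/M.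
(* Here m / M = c n / (n + 1) = c (1 - s) with s = 1 / (n + 1). *)
have -> : c * (1 - M^-1) = m%:R / M.
  by rewrite mE /M -natr1; field; rewrite natr1.
have -> : 1 - m%:R / M = N / M by rewrite /N; field.
have m0 : m%:R != 0 :> R by rewrite mE mulf_neq0.
move: (i%:R) (m%:R) In m0 => a b a0 b0; clearbody N M.
by field; rewrite ?a0 ?b0 ?N0 ?M0 ?c1n.
Qed.

End Limit.

Unset Implicit Arguments.

Theorem proposition3p8 (R : realType) (i : nat) (c : R)
  (hi : (1 <= i)%N) (hc0 : 0 < c) (hc1 : c < 1) :
  (fun n : nat =>
     cov_preference_unattempted R i (Num.truncn (c * n%:R)) n
       / (- (i%:R / (2 * (1 - c) ^+ 2))))
    @ within [set n : nat | c * n%:R \is a Num.nat] \oo --> (1 : R).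
Proof.
(* The error constant of [defect_ge]; [defect_le] has no error term, whence 0 in the upper bound. *)
set K := 3 / (1 - c) ^+ 4.
apply: (@squeeze_cvgr _ _ _ _ (fun n => cov_ratio c i%:R K (harmonic n))
   (fun n => cov_ratio c i%:R 0 (harmonic n))); last 2 first.
- apply: cvg_trans; last exact: (@cvg_cov_ratio R c i%:R K hc0 hc1).
  by apply: cvg_app; exact: cvg_within.
- apply: cvg_trans; last exact: (@cvg_cov_ratio R c i%:R 0 hc0 hc1).
  by apply: cvg_app; exact: cvg_within.
(* The threshold n > i / (1 - c) gives i + c n <= n, so the unattempted spot of index i exists. *)
rewrite near_withinE; exists (Num.truncn (i%:R / (1 - c))).+1 => // n /= lenn cn.
have c1 : 0 < 1 - c by rewrite subr_gt0.
have n0 : (0 < n)%N by apply: leq_trans lenn.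
have nR : 0 < n%:R :> R by rewrite ltr0n.
set m := Num.truncn (c * n%:R).
have mE : m%:R = c * n%:R by apply: truncnK.
have m0 : (0 < m)%N by rewrite -(ltr0n R) mE mulr_gt0.
have imn : (i + m <= n)%N.
  rewrite -(ler_nat R) natrD mE -lerBrDr -{1}[n%:R]mul1r -mulrBl mulrC.
  rewrite -ler_pdivrMr //; apply: ltW; apply: lt_le_trans (truncnS_gt _) _.
  by rewrite ler_nat.
rewrite cov_preference_unattemptedE //.
set M : R := n.+1%:R; set N := M - m%:R.
have M0 : 0 < M by rewrite ltr0n.
have NE : N = (n.+1 - m)%:R by rewrite natrB //; lia.
have N0 : 0 < N by rewrite NE ltr0n; lia.
have iN : i%:R <= N by rewrite NE ler_nat; lia.
have iR : 0 < i%:R :> R by rewrite ltr0n.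
(* The ratio as a function of the defect; two minus signs cancel, so bounds keep their direction. *)
pose Phi d := - (i%:R * (N - i%:R) * M * d) / (2 * N * m%:R) /
   (- (i%:R / (2 * (1 - c) ^+ 2))).
have Phi_mono d d' : d <= d' -> Phi d <= Phi d'.
  have PhiE x : Phi x = ((N - i%:R) * M / N / m%:R * (1 - c) ^+ 2) * x.
    rewrite /Phi; field.
    by rewrite !gt_eqF ?ltr0n.
  rewrite !PhiE => dd; apply: ler_wpM2l => //.
  rewrite mulr_ge0 ?sqr_ge0 // divr_ge0 ?ler0n // divr_ge0 ?(ltW N0) //.
  by rewrite mulr_ge0 ?subr_ge0 // ltW.
rewrite -/(defect M m) -/(Phi _).
rewrite -(@cov_ratioE R c i m n _ K hc0 hc1 hi n0 mE erefl).
rewrite -(@cov_ratioE R c i m n _ 0 hc0 hc1 hi n0 mE erefl).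
rewrite -/M -/N -!/(Phi _) mul0r subr0; apply/andP; split; apply: Phi_mono.
  apply: defect_ge => //; by rewrite mE ler_pM2l // ler_nat.
by apply: defect_le => //; rewrite -subr_gt0.
Qed.
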